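(* Let $d\ge1$, $n\ge d+1$, $T=\{t_1<\dots<t_n\}\subset\mathbb R$, and $\xi\in\mathbb R^{d+1}\setminus\{0\}$ with $q_\xi(t)\ne 0$ for all $t\in T$. Let $S\subset T$ with $|S|=d$. The unique affine hyperplane (inside $\{z:\sum_i\xi_iz_i=1\}$) through the points $\nu_d(t)/q_\xi(t)$, $t\in S$, is a facet-supporting hyperplane of $P_\xi(T)$ if and only if the values $$\lambda_{\xi,S}(t)=\frac{\prod_{s\in S}(t-s)}{q_\xi(t)},\qquad t\in T\setminus S,$$ all have the same sign. Moreover, this hyperplane contains no other generating point $\nu_d(t)/q_\xi(t)$, $t\in T\setminus S$.
   Context: $\nu_d(t)=(1,t,t^2,\dots,t^d)\in\mathbb R^{d+1}$ and $q_\xi(t)=\sum_{i=0}^d\xi_it^i$. The Veronese polytope is $P_\xi(T)=\mathrm{conv}\{\nu_d(t)/q_\xi(t):t\in T\}\subset\mathbb R^{d+1}$, a $d$-dimensional polytope lying in the affine hyperplane $\{z:\sum_i\xi_iz_i=1\}$; the points $\nu_d(t)/q_\xi(t)$ are its generating points. *)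

(* Defs.v *)
From HB Require Import structures.
From mathcomp Require Import all_boot all_order all_algebra.
From mathcomp Require Import boolp classical_sets reals convex.

Set Implicit Arguments.
Unset Strict Implicit.
Unset Printing Implicit Defensive.

Import Order.TTheory GRing.Theory Num.Theory.

Local Open Scope classical_set_scope.
Local Open Scope ring_scope.

Section AffineGeometry.
Variables (R : realType) (V : vectType R).
Implicit Types (A H L P : set V) (k : nat).

Definition conv_hull A : set V := smallest (@convex_set R V) A.

(* L is a translate of a k-dimensional linear subspace; in particular L is
   nonempty. *)
Definition affine_subspace k L : Prop :=
  exists (p : V) (U : {vspace V}), \dim U = k /\ L = [set x | x - p \in U].

(* The affine hull of A, i.e. the least affine subspace containing A, exists
   and has dimension k. *)
Definition affine_dim A k : Prop :=
  exists L : set V,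
    [/\ affine_subspace k L, A `<=` L &
        forall k' L', affine_subspace k' L' -> A `<=` L' -> L `<=` L'].

Definition affine_hyperplane_in H L : Prop :=
  L `<=` H /\ exists k, affine_subspace k.+1 H /\ affine_subspace k L.

(* Supporting hyperplanes are relative to the ambient affine space H: the
   polytopes considered below are not full-dimensional in V, only in H. *)
Definition supporting_hyperplane_in H P L : Prop :=
  affine_hyperplane_in H L /\
  exists (l : {linear V -> R^o}) (b : R),
    [/\ L = H `&` [set z | l z = b], P `<=` [set z | l z <= b :> R] &
        P `&` L !=set0].

Definition facet_supporting_hyperplane_in H P L : Prop :=
  supporting_hyperplane_in H P L /\
  exists k, affine_dim P k.+1 /\ affine_dim (P `&` L) k.

End AffineGeometry.

Section Veronese.
Variables (R : realType) (d : nat).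
Implicit Types (xi : 'rV[R]_d.+1) (x : R).

Definition moment_curve x : 'rV[R]_d.+1 := \row_(i < d.+1) x ^+ i.

Definition q_xi xi x : R := \sum_(i < d.+1) xi 0 i * x ^+ i.

Definition generating_point xi x : 'rV[R]_d.+1 :=
  (q_xi xi x)^-1 *: moment_curve x.

Definition veronese_polytope xi (T : set R) : set 'rV[R]_d.+1 :=
  conv_hull (generating_point xi @` T).

Definition ambient_hyperplane xi : set 'rV[R]_d.+1 :=
  [set z | \sum_(i < d.+1) xi 0 i * z 0 i = 1].

(* The set S of parameters is given by indices into t_1 < ... < t_n. *)
Definition lambda_xi xi (n : nat) (t : 'I_n -> R) (S : {set 'I_n}) x : R :=
  (\prod_(j in S) (x - t j)) / q_xi xi x.

End Veronese.

(* Main.v *)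
(* Up to the nonzero factor 1/q_xi(x), pairing a covector with a generating point evaluates a polynomial of degree at most d. Hence any d+1 generating points are linearly independent, and the polynomial prod_(s in S) (X - s) gives a functional whose value at the generating point of x is lambda_(xi,S)(x). Its kernel cuts the ambient hyperplane in L; since this value vanishes exactly on S, L is supporting iff it has a constant sign off S, every affine functional vanishing on L being a multiple of it. *)
From HB Require Import structures.
Require Import Defs.
From mathcomp Require Import all_boot all_order all_algebra.
From mathcomp Require Import interval_inference boolp classical_sets reals convex.

Set Implicit Arguments.
Unset Strict Implicit.
Unset Printing Implicit Defensive.

Import Order.TTheory GRing.Theory Num.Theory.

Local Open Scope classical_set_scope.
Local Open Scope ring_scope.

(** * Half-spaces, dimensions of kernels, and affine subspaces determined by independent points *)

Section AffineSubspaces.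
Variables (R : realType) (V : vectType R).
Implicit Types (A M : set V) (X : seq V) (U : {vspace V}).

Lemma conv_hull_le (l : {linear V -> R^o}) (b : R) A :
  A `<=` [set z | l z <= b :> R] -> conv_hull A `<=` [set z | l z <= b :> R].
Proof.
move=> leA; apply: smallest_sub leA => x y k.
rewrite !inE /= => lex ley.
rewrite linearD !linearZ /=.
have -> : b = k%:num * b + (1 - k%:num) * b by rewrite -mulrDl subrKC mul1r.
by apply: lerD; apply: ler_wpM2l => //; rewrite subr_ge0.
Qed.

(** Rank-nullity: the image of [U] is nonzero inside a one-dimensional space, so it is a line. *)
Lemma dim_cap_lker U (f : 'Hom(V, R^o)) v :
  v \in U -> f v != 0 -> (\dim (U :&: lker f)).+1 = \dim U.
Proof.
move=> Uv fv; have := limg_ker_dim f U.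
suff -> : \dim (f @: U) = 1%N by rewrite addn1.
apply/eqP; rewrite eqn_leq (leq_trans (dimvS (subvf _))) ?dimvf //=.
have : \dim <[f v]> = 1%N by rewrite dim_vline fv.
by move=> <-; apply: dimvS; rewrite -memvE memv_img.
Qed.

(** The linear rank of [X] exceeds that of the differences [x - x0] by at most one. These
    differences therefore have rank at least [k] and fill the whole direction of [M]; since they
    also lie in the direction of [M'], all of [M] does, up to translation by a common point. *)
Lemma affine_subspace_min k k' M M' X :
  affine_subspace k M -> affine_subspace k' M' ->
  (forall x, x \in X -> M x) -> (forall x, x \in X -> M' x) ->
  (k < \dim <<X>>)%N -> M `<=` M'.
Proof.
case: X => [|x0 X]; first by rewrite span_nil dimv0.
move=> [p [U [dimU ->]]] [p' [U' [_ ->]]] MX M'X kX.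
have sub q (W : {vspace V}) : (forall x, x \in x0 :: X -> x - q \in W) ->
    (<<[seq (x - x0)%R | x <- X]>> <= W)%VS.
  move=> WX; apply/span_subvP => _ /mapP[x xX ->].
  have -> : x - x0 = (x - q) - (x0 - q) by rewrite opprB addrA subrK.
  by apply: memvB; apply: WX; rewrite ?mem_head // inE xX orbT.
set D := <<_>>%VS in sub.
have DU : D = U.
  apply/eqP; rewrite eqEdim (sub _ _ MX) dimU -ltnS.
  apply: leq_trans kX _; apply: (@leq_trans (\dim (<[x0]> + D)%VS)).
    apply/dimvS/span_subvP => x; rewrite inE => /predU1P[->|xX].
      by rewrite (subvP (addvSl _ _)) ?memv_line.
    rewrite -(subrK x0 x) addrC memv_add ?memv_line //.
    by apply: memv_span; apply: map_f.
  rewrite (leq_trans (dimv_add_leqif _ _)) // dim_vline -add1n leq_add2r.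
  exact: leq_b1.
move=> z /= Uz.
have -> : z - p' = (z - x0) + (x0 - p') by rewrite addrA subrK.
apply: memvD; last by apply: M'X; rewrite mem_head.
apply: (subvP (sub _ _ M'X)); rewrite DU.
have -> : z - x0 = (z - p) - (x0 - p) by rewrite opprB addrA subrK.
by apply: memvB => //; apply: MX; rewrite mem_head.
Qed.

(** Certifies an affine dimension by a finite list of points of [A] with large enough linear rank:
    [M] is then the affine hull. *)
Lemma affine_dim_intro k A M X :
  affine_subspace k M -> A `<=` M -> (forall x, x \in X -> A x) ->
  (k < \dim <<X>>)%N -> affine_dim A k.
Proof.
move=> affM AM XA kX; exists M; split=> // k' M' affM' AM'.
by apply: (affine_subspace_min affM affM' _ _ kX) => x /XA; [apply: AM|apply: AM'].
Qed.

(** The direction of an affine subspace does not depend on the base point chosen to describe it. *)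
Lemma affine_subspace_dim_inj k k' M :
  affine_subspace k M -> affine_subspace k' M -> k = k'.
Proof.
move=> [p [U [<- ->]]] [p' [U' [<- E]]].
have mem x : (x - p \in U) = (x - p' \in U').
  by have := congr1 (fun Q : set V => Q x) E; rewrite /= => e; apply/idP/idP; rewrite e.
have pU' : p - p' \in U' by rewrite -mem subrr mem0v.
congr (\dim _); apply/vspaceP => u; rewrite -[in LHS](addrK p u) mem.
by rewrite -addrA rpredDr.
Qed.

End AffineSubspaces.

(** * Covectors as polynomials, independence of generating points, dimensions of hyperplane
    sections *)

Section Veronese.
Variables (R : realType) (d : nat) (xi : 'rV[R]_d.+1).

Definition dot (w z : 'rV[R]_d.+1) : R^o := \sum_(i < d.+1) w 0 i * z 0 i.

Fact dot_is_linear w : linear (dot w).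
Proof.
move=> a x y; rewrite /dot scaler_sumr -big_split /=; apply: eq_bigr => i _.
by rewrite !mxE mulrDr mulrCA.
Qed.

HB.instance Definition _ w :=
  GRing.isLinear.Build R 'rV[R]_d.+1 R^o _ (dot w) (dot_is_linear w).

Lemma dot_generating_point (p : {poly R}) x : (size p <= d.+1)%N ->
  dot (poly_rV p) (generating_point xi x) = p.[x] / q_xi xi x.
Proof.
move=> sp; rewrite linearZ (horner_coef_wide x sp) mulrC; apply: (congr1 ( *%R _)).
by apply: eq_bigr => i _; rewrite !mxE.
Qed.

Lemma dot_xi_generating_point x : q_xi xi x != 0 ->
  dot xi (generating_point xi x) = 1.
Proof.
move=> qx; rewrite linearZ -[RHS](mulVf qx); apply: (congr1 ( *%R _)).
by apply: eq_bigr => i _; rewrite !mxE.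
Qed.

(** Coefficients of the monic polynomial with roots [s]. [poly_rV] truncates above degree [d], so
    this is faithful only when [size s <= d]. *)
Definition root_covector (s : seq R) : 'rV[R]_d.+1 :=
  poly_rV (\prod_(y <- s) ('X - y%:P)).

Lemma dot_root_covector s x : (size s <= d)%N ->
  dot (root_covector s) (generating_point xi x) =
  (\prod_(y <- s) (x - y)) / q_xi xi x.
Proof.
move=> sd; rewrite dot_generating_point ?size_prod_XsubC // horner_prod.
by congr (_ / _); apply: eq_bigr => y _; rewrite hornerXsubC.
Qed.

(* Each point is separated from the span of the next ones by the covector of the polynomial vanishing at their parameters. *)
Lemma free_generating_points s : uniq s -> (size s <= d.+1)%N ->
  (forall x, x \in s -> q_xi xi x != 0) ->
  free [seq generating_point xi x | x <- s].
Proof.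
elim: s => [|x s IHs] /=; first by rewrite nil_free.
move=> /andP[xs us] sd qs; rewrite free_cons IHs ?(ltnW sd) //; last first.
  by move=> y ys; rewrite qs // inE ys orbT.
rewrite andbT; apply/negP => gs.
have /subvP/(_ _ gs) : (<<[seq generating_point xi y | y <- s]>> <=
    lker (linfun (dot (root_covector s))))%VS.
  apply/span_subvP => _ /mapP[y ys ->].
  by rewrite memv_ker lfunE /= dot_root_covector // (big_rem y) //= subrr !mul0r.
rewrite memv_ker lfunE /= dot_root_covector // mulf_eq0 invr_eq0.
rewrite (negPf (qs _ (mem_head _ _))) orbF prodf_seq_eq0 => /hasP[y ys].
by rewrite subr_eq0 => /eqP xy; rewrite xy ys in xs.
Qed.

Lemma dim_generating_points s : uniq s -> (size s <= d.+1)%N ->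
  (forall x, x \in s -> q_xi xi x != 0) ->
  \dim <<[seq generating_point xi x | x <- s]>> = size s.
Proof.
by move=> us sd qs; rewrite (eqP (free_generating_points us sd qs)) size_map.
Qed.

Lemma ambient_hyperplane_lker p : dot xi p = 1 ->
  ambient_hyperplane xi = [set z | z - p \in lker (linfun (dot xi))].
Proof.
move=> p1; apply/seteqP; split=> z /=; rewrite memv_ker lfunE linearB /= p1 subr_eq0.
  by move=> /eqP.
by move=> /eqP.
Qed.

Lemma dim_lker_dot_xi p : dot xi p = 1 -> \dim (lker (linfun (dot xi))) = d.
Proof.
move=> p1; apply: succn_inj; rewrite -[lker _]capfv (@dim_cap_lker _ _ _ _ p) ?memvf //.
  by rewrite dimvf /= /dim /= mul1n.
by rewrite lfunE /= p1 oner_neq0.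
Qed.

Lemma affine_ambient_hyperplane p : dot xi p = 1 ->
  affine_subspace d (ambient_hyperplane xi).
Proof.
move=> p1; exists p, (lker (linfun (dot xi))).
by rewrite (dim_lker_dot_xi p1) (ambient_hyperplane_lker p1).
Qed.

(** The vector [v - p] lies in the kernel of [xi] but not in that of [w], so the second equation
    lowers the dimension by exactly one. *)
Lemma affine_hyperplane_slice w p v : dot xi p = 1 -> dot w p = 0 ->
  dot xi v = 1 -> dot w v != 0 -> (0 < d)%N ->
  affine_subspace d.-1 (ambient_hyperplane xi `&` [set z | dot w z = 0]).
Proof.
move=> xp wp xv wv d0.
exists p, (lker (linfun (dot xi)) :&: lker (linfun (dot w)))%VS; split.
  apply: succn_inj; rewrite (@dim_cap_lker _ _ _ _ (v - p)).
  - by rewrite prednK // (dim_lker_dot_xi xp).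
  - by rewrite memv_ker lfunE linearB /= xv xp subrr.
  - by rewrite lfunE linearB /= wp subr0.
rewrite (ambient_hyperplane_lker xp); apply/seteqP; split=> z /=.
  by rewrite memv_cap => -[-> wz]; rewrite memv_ker lfunE linearB /= wz wp subrr eqxx.
rewrite memv_cap => /andP[-> ]; rewrite memv_ker lfunE linearB /= wp subr0.
by move=> /eqP.
Qed.

End Veronese.

Theorem theorem2p7 (R : realType) (d n : nat) (hd : (1 <= d)%N)
    (hn : (d.+1 <= n)%N) (t : 'I_n -> R)
    (ht : forall i j : 'I_n, (i < j)%N -> t i < t j)
    (xi : 'rV[R]_d.+1) (hxi : xi != 0)
    (hq : forall i : 'I_n, q_xi xi (t i) != 0)
    (S : {set 'I_n}) (hS : #|S| = d) :
  exists L : set 'rV[R]_d.+1,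
    [/\ unique (fun L' : set 'rV[R]_d.+1 =>
          affine_hyperplane_in (ambient_hyperplane xi) L' /\
          forall i, i \in S -> L' (generating_point xi (t i))) L,
        facet_supporting_hyperplane_in (ambient_hyperplane xi)
          (veronese_polytope xi (range t)) L <->
        (forall i j, i \notin S -> j \notin S ->
          Num.sg (lambda_xi xi t S (t i)) = Num.sg (lambda_xi xi t S (t j))) &
        forall i, i \notin S -> ~ L (generating_point xi (t i))].

Proof.
have tinj : injective t.
  move=> i j tij; apply: val_inj.
  by case: (ltngtP i j) => // /ht; rewrite tij ltxx.
set s := [seq t j | j <- enum S].
have ss : size s = d by rewrite size_map -cardE.
have us : uniq s by rewrite map_inj_uniq ?enum_uniq.
have mem_s i : (t i \in s) = (i \in S) by rewrite mem_map ?mem_enum.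
have qs x : x \in s -> q_xi xi x != 0 by move=> /mapP[i _ ->].
set g := fun i => generating_point xi (t i).
set H := ambient_hyperplane xi; set P := veronese_polytope xi (range t).
pose w : 'rV[R]_d.+1 := root_covector d s.
have wE i : dot w (g i) = lambda_xi xi t S (t i).
  by rewrite dot_root_covector ?ss // big_map big_enum.
have xiE i : dot xi (g i) = 1 by apply: dot_xi_generating_point.
(* Injectivity of [t] ensures that [w] vanishes at no generating point outside [S]; this also
   settles the last claim of the theorem. *)
have wS i : (dot w (g i) == 0) = (i \in S).
  rewrite wE mulf_eq0 invr_eq0 (negPf (hq i)) orbF prodf_seq_eq0.
  rewrite -mem_s; apply/hasP/idP => [[j _ /andP[jS]]|].
    by rewrite subr_eq0 => /eqP/tinj->; rewrite mem_s.
  by rewrite mem_s => iS; exists i; rewrite ?mem_index_enum // iS subrr eqxx.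
have [j0 j0S] : exists j, j \in S by apply/set0Pn; rewrite -card_gt0 hS.
have [i0 i0S] : exists i, i \notin S.
  apply/existsP; rewrite -negb_forall; apply/negP => /forallP allS.
  suff : (n <= d)%N by rewrite leqNgt hn.
  by rewrite -hS -{1}(card_ord n); apply/subset_leq_card/fintype.subsetP => i _.
have w0 : dot w (g j0) = 0 by apply/eqP; rewrite wS.
set L := H `&` [set z | dot w z = 0].
have affH : affine_subspace d H := affine_ambient_hyperplane (xiE j0).
have affL : affine_subspace d.-1 L.
  by apply: (affine_hyperplane_slice (xiE j0) w0 (xiE i0)); rewrite ?wS.
have Hg i : H (g i) := xiE i.
have Lg i : i \in S -> L (g i) by move=> iS; split=> //; apply/eqP; rewrite wS.
have Pg i : P (g i) by apply: sub_gen_smallest; exists (t i) => //; exists i.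
have dimS : \dim <<[seq generating_point xi x | x <- s]>> = d.
  by rewrite dim_generating_points ?ss.
have span_s i : i \notin S ->
    \dim <<[seq generating_point xi x | x <- t i :: s]>> = d.+1.
  move=> iS; rewrite dim_generating_points /= ?ss ?mem_s ?iS //.
  by move=> x; rewrite inE => /predU1P[->|/qs].
have PH : P `<=` H.
  (* The equation of [H] is split into two half-spaces, [e = 1] and [e = -1], to which
     [conv_hull_le] applies. *)
  have PHsg (e : R) : P `<=` [set z | (e *: linfun (dot xi))%VF z <= e :> R].
    apply: conv_hull_le => _ [_ [i _ <-] <-] /=.
    by rewrite !lfunE /= lfunE /= xiE [_ *: _]mulr1.
  move=> z Pz; apply/eqP; rewrite eq_le.
  have := PHsg (-1) z Pz; have := PHsg 1 z Pz.
  by rewrite /= !lfunE /= !lfunE /= scale1r scaleN1r lerN2 => -> ->.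
have hypL : affine_hyperplane_in H L.
  by split; [move=> z []|exists d.-1; rewrite prednK].
have sL x : x \in [seq generating_point xi y | y <- s] -> L x.
  by move=> /mapP[_ /mapP[i iS ->] ->]; apply: Lg; rewrite mem_enum in iS.
exists L; split.
- split=> [|L' [[_ [k [affH' affL']]] L'g]]; first by split.
  (* A competing hyperplane must have dimension [d - 1], so the [d] independent points of [S]
     determine it. *)
  have kd : k.+1 = d := affine_subspace_dim_inj affH' affH.
  have sL' x : x \in [seq generating_point xi y | y <- s] -> L' x.
    by move=> /mapP[_ /mapP[i iS ->] ->]; apply: L'g; rewrite mem_enum in iS.
  apply/seteqP; split.
    by apply: (affine_subspace_min affL affL' sL sL'); rewrite dimS prednK.
  by apply: (affine_subspace_min affL' affL sL' sL); rewrite dimS kd.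
- split=> [[[_ [l [b [LE lb _]]]] _] i j iS jS|sgl].
    (* The inequality is strict because [L] misses the generating points outside [S]. *)
    have lt0 m : m \notin S -> l (g m) - b < 0 :> R.
      move=> mS; rewrite subr_lt0 lt_neqAle (lb _ (Pg m)) andbT.
      apply/eqP => lm; have : L (g m) by rewrite LE.
      by move=> [_ /= /eqP]; rewrite wS (negPf mS).
    (* [l - b xi] and [w] both vanish on the points of [S], hence are proportional. *)
    pose F := (dot w (g i) *: (linfun l - (b : R) *: linfun (dot xi))
               - (l (g i) - b : R) *: linfun (dot w))%VF.
    have FE z : F z =
        dot w (g i) * (l z - b * dot xi z) - (l (g i) - b) * dot w z :> R.
      by rewrite !(add_lfunE, opp_lfunE, scale_lfunE, lfunE).
    (* The coefficients of [F] make it vanish at [g i] as well as on [S], hence on a basis. *)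
    have : (fullv <= lker F)%VS.
      have /eqP <- : <<[seq generating_point xi x | x <- t i :: s]>>%VS == fullv.
        by rewrite eqEdim subvf span_s // dimvf /= /dim /= mul1n.
      apply/span_subvP => x; rewrite map_cons inE memv_ker FE => /predU1P[->|xs].
        by rewrite -/(g i) xiE mulr1 [X in X - _]mulrC subrr.
      have Lx := sL _ xs; have [Hx wx] := Lx.
      have [_ lx] : (H `&` [set z | l z = b]) x by rewrite -LE.
      have xix : dot xi x = 1 := Hx.
      by rewrite xix wx lx mulr1 subrr !mulr0 subr0.
    (* At [g j] this reads [dot w (g i) * (l (g j) - b) = (l (g i) - b) * dot w (g j)]; both factors
       involving [l] are negative, so the lambda values share their sign. *)
    move=> /subvP/(_ (g j) (memvf _)).
    rewrite memv_ker FE xiE mulr1 subr_eq0 => /eqP/(congr1 Num.sg).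
    rewrite !sgrM (ltr0_sg (lt0 _ iS)) (ltr0_sg (lt0 _ jS)) mulrN1 mulN1r => /oppr_inj.
    by rewrite !wE /lambda_xi !sgrM.
  set e := Num.sg (lambda_xi xi t S (t i0)).
  split; last first.
    (* The points of [S] together with [g i0] certify dimension [d] for [P]; those of [S] alone
       certify [d - 1] for the face. *)
    exists d.-1; rewrite prednK //; split.
      apply: (@affine_dim_intro _ _ _ _ H
          [seq generating_point xi x | x <- t i0 :: s]) => //.
        by move=> x; rewrite inE => /predU1P[->|/mapP[_ /mapP[i _ ->] ->]]; apply: Pg.
      by rewrite span_s.
    apply: (@affine_dim_intro _ _ _ _ L
        [seq generating_point xi x | x <- s]) => //.
    - move=> x xs; split; last exact: sL.
      by case/mapP: xs => _ /mapP[i _ ->] ->; apply: Pg.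
    - by rewrite dimS prednK.
  (* Multiplying [w] by minus the common sign [e] makes it equal to minus an absolute value off [S]
     and zero on [S], so its maximum over [P] is 0. *)
  split=> //; exists (- e *: linfun (dot w))%VF, 0.
  have FE z : (- e *: linfun (dot w))%VF z = - (e * dot w z) :> R.
    by rewrite !lfunE /= lfunE /= scaleNr.
  have e0 : e != 0 by rewrite sgr_eq0 -wE wS.
  split.
  - apply/seteqP; split=> z [Hz /= wz]; split=> //=; move: wz; rewrite FE.
      by move=> ->; rewrite mulr0 oppr0.
    by move=> /eqP; rewrite oppr_eq0 mulf_eq0 (negPf e0) => /eqP.
  - apply: conv_hull_le => _ [_ [i _ <-] <-] /=.
    rewrite FE oppr_le0 -/(g i); have [iS|iS] := boolP (i \in S).
      by have [_ ->] := Lg i iS; rewrite mulr0.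
    by rewrite wE /e (sgl i0 i) // -normrEsg.
  - by exists (g j0); split; [apply: Pg|apply: Lg].
- by move=> i iS [_ /= /eqP]; rewrite wS (negPf iS).
Qed.
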